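(* Let $G=(V,E)$ be a graph that belongs to the class $\mathcal{F}$ and has at least two vertices, and let $X\subseteq V$ be the set of cut vertices of $G$. Then $\mathrm{evc}(G)=\mathrm{mvc}(G)$ if and only if for every vertex $v\in V\setminus X$ there exists a minimum vertex cover $S_v$ of $G$ such that $X\cup\{v\}\subseteq S_v$.
   Context: All graphs are finite and simple. $\mathrm{mvc}(G)$ denotes the minimum cardinality of a vertex cover of $G$. A vertex cover $S$ is connected if the induced subgraph $G[S]$ is connected. Eternal vertex cover game: guards are placed on vertices of $G$, at most one guard per vertex; the set of occupied vertices is a configuration. In each round an attacker chooses an edge $uv$; the defender responds by moving guards simultaneously, each guard either staying put or moving to an adjacent vertex, such that at least one guard moves across the attacked edge (from one endpoint to the other), and after the move at most one guard is on each vertex; the number of guards never changes. An eternal vertex cover class of $G$ is a family $\mathcal{C}$ of vertex covers of $G$, all of the same cardinality, such that for every configuration $S\in\mathcal{C}$ and every attacked edge, the attack can be defended by a legal move leading to a configuration in $\mathcal{C}$. The eternal vertex cover number $\mathrm{evc}(G)$ is the minimum cardinality of a configuration of an eternal vertex cover class of $G$. The class $\mathcal{F}$ consists of all connected graphs $G$ such that every minimum vertex cover of $G$ that contains all cut vertices of $G$ induces a connected subgraph of $G$. *)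

(* Defs.v *)
(* Graphs over MathComp: a finite simple graph is a symmetric irreflexive
   relation [e] on a finType [T].  Every definition below is a boolean on finite
   data; in particular a family of configurations is a [{set {set T}}]. *)
From mathcomp Require Import all_boot.

Set Implicit Arguments.
Unset Strict Implicit.
Unset Printing Implicit Defensive.

Section Graph.

Variables (T : finType) (e : rel T).
Implicit Types (S : {set T}) (C : {set {set T}}) (f : {ffun T -> T}).

(* The induced subgraph G[S] is kept on the carrier [T], the vertices outside
   [S] being isolated, so notions about G[S] must be relativised to [S]. *)
Definition induced S : rel T := [rel x y in S | e x y].

(* Convention: the graph with no vertex is connected. *)
Definition connected_on S : bool :=
  [forall x in S, forall y in S, connect (induced S) x y].

Definition vertex_cover S : bool :=
  [forall x, forall y, e x y ==> (x \in S) || (y \in S)].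

(* [setT] is a vertex cover, so the default of the arg min is harmless. *)
Definition mvc : nat := #|[arg min_(S < [set: T] | vertex_cover S) #|S|]|.

Definition min_vertex_cover S : bool := vertex_cover S && (#|S| == mvc).

(* The vertices whose deletion increases the number of connected components. *)
Definition cut_vertices : {set T} :=
  [set x | n_comp e T < n_comp (induced (~: [set x])) (~: [set x])].

(* [f] sends the guard on [x \in S] to [f x]; its values outside [S] are
   irrelevant.  The guards on both ends of the attacked edge may swap. *)
Definition defends (u v : T) S S' : bool :=
  [exists f : {ffun T -> T},
    [&& [forall x in S, (f x == x) || e x (f x)],
        dinjectiveb f (mem S),
        f @: S == S'
      & ((u \in S) && (f u == v)) || ((v \in S) && (f v == u))]].

Definition evc_class C : bool :=
  [&& [forall S in C, vertex_cover S],
      [forall S in C, forall S' in C, #|S| == #|S'|]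
    & [forall S in C, forall u, forall v,
         e u v ==> [exists S' in C, defends u v S S']]].

Definition evc_configuration S : bool :=
  [exists C, evc_class C && (S \in C)].

(* The default [setT] of the arg min is itself an admissible configuration,
   see [evc_configurationT]. *)
Definition evc : nat := #|[arg min_(S < [set: T] | evc_configuration S) #|S|]|.

Definition class_F : bool :=
  connected_on [set: T] &&
  [forall S, min_vertex_cover S && (cut_vertices \subset S)
               ==> connected_on S].

Lemma vertex_coverT : vertex_cover [set: T].
Proof. by apply/forallP=> x; apply/forallP=> y; rewrite inE implybT. Qed.

Lemma evc_configurationT : symmetric e -> evc_configuration [set: T].
Proof.
move=> e_sym; apply/existsP; exists [set [set: T]]; rewrite inE eqxx andbT.
apply/and3P; split.
- by apply/forall_inP=> S /set1P->; apply: vertex_coverT.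
- by apply/forall_inP=> S /set1P->; apply/forall_inP=> S' /set1P->.
apply/forall_inP=> S /set1P->; apply/forallP=> u; apply/forallP=> v.
apply/implyP=> euv; apply/existsP; exists [set: T]; rewrite inE eqxx /=.
pose g x := if x == u then v else if x == v then u else x.
have gK : involutive g.
  move=> x; rewrite /g; case: (eqVneq x u) => [->|xu].
    by rewrite eqxx; case: eqVneq.
  case: (eqVneq x v) => [->|xv]; first by rewrite eqxx.
  by rewrite (negPf xu) (negPf xv).
have fE : [ffun x => g x] =1 g by move=> x; rewrite ffunE.
apply/existsP; exists [ffun x => g x]; apply/and4P; split.
- apply/forall_inP=> x _; rewrite fE /g; case: (eqVneq x u) => [->|_].
    by rewrite euv orbT.
  by case: (eqVneq x v) => [->|_]; rewrite ?eqxx // e_sym euv orbT.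
- by apply/dinjectiveP=> x y _ _; rewrite !fE; apply: (can_inj gK).
- rewrite eqEsubset subsetT; apply/subsetP=> x _; apply/imsetP.
  by exists (g x); rewrite // fE gK.
by rewrite inE fE /g !eqxx.
Qed.

End Graph.

(* Main.v *)
(* Necessity.  Let an eternal class consist of minimum vertex covers, and let S
   in it miss a cut vertex x.  Split G - x into two parts A and B without edges
   between them.  Answering an attack on an edge from x to A takes one guard out
   of A, and likewise for B; gluing the A-part of the first answer, the B-part of
   the second and x gives a vertex cover with fewer than #|S| vertices.  So every
   configuration contains all cut vertices, and attacking an edge at v forces a
   configuration that contains v as well.

   Sufficiency.  The minimum vertex covers containing all cut vertices form an
   eternal class.  Let uv be attacked, with v outside S, and choose such a cover
   S' containing v with #|S :\: S'| minimum.  Minimality yields Hall's condition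
   from S :\: S' minus any of its vertices x to S' :\: S minus v, and
   connectedness of G[S] yields a path in S from u to some x in S :\: S' whose
   other vertices lie in S'.  The guard on u moves to v, the guards on the path
   advance by one step towards u, and the rest of S :\: S' follows a Hall
   matching. *)
Require Import Defs.
From mathcomp Require Import all_boot.
From mathcomp Require Import perm.
From mathcomp Require Import zify.

Set Implicit Arguments.
Unset Strict Implicit.
Unset Printing Implicit Defensive.

(** * Hall's marriage theorem for a relation on a finite type *)

Definition nbhd (T : finType) (r : rel T) (B : {set T}) : {set T} :=
  [set y | [exists x in B, r x y]].

Lemma nbhdP (T : finType) (r : rel T) (B : {set T}) y :
  reflect (exists2 x, x \in B & r x y) (y \in nbhd r B).
Proof. by rewrite inE; apply: exists_inP. Qed.

(** Induction on [#|A|]. A nonempty proper subset [B] with at most [#|B|] neighbours is matched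
    first and its neighbours are withdrawn. If there is none, any [a] may take any neighbour [y]. *)
Theorem hall (T : finType) (r : rel T) (A : {set T}) :
    (forall B : {set T}, B \subset A -> #|B| <= #|nbhd r B|) ->
  exists f : T -> T, {in A, forall x, r x (f x)} /\ {in A &, injective f}.
Proof.
have [n] := ubnP #|A|; elim: n => // n IHn in r A *; rewrite ltnS => leAn hallA.
have [->|[a aA]] := set_0Vmem A.
  by exists id; split=> x; rewrite inE.
have [/existsP[B /and3P[BA Bn0 tight]] | noTight] :=
  boolP [exists B : {set T}, [&& B \proper A, B != set0 & #|nbhd r B| <= #|B|]].
  have ltBA := proper_card BA; have subBA := proper_sub BA.
  have [|C CB|f1 [f1r f1I]] := IHn r B; first by lia.
    by apply: hallA; apply: subset_trans CB subBA.
  pose r' x y := r x y && (y \notin nbhd r B).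
  have cardAB : #|A :\: B| = #|A| - #|B| by rewrite cardsD (setIidPr subBA).
  have B_gt0 : 0 < #|B| by rewrite card_gt0.
  have [||f2 [f2r f2I]] := IHn r' (A :\: B); first by lia.
    move=> C; rewrite subsetD => /andP[CA CB].
    (* [B] accounts for at most [#|B|] of the neighbours of [B :|: C], so at least [#|C|] of them
       are [r']-neighbours of [C]. *)
    have := hallA (B :|: C); rewrite subUset subBA CA => /(_ isT).
    rewrite cardsU setIC disjoint_setI0 // cards0 subn0.
    have /subset_leq_card : nbhd r (B :|: C) \subset nbhd r B :|: nbhd r' C.
      apply/subsetP=> y /nbhdP[x + rxy]; rewrite inE => /orP[xB|xC].
        by rewrite inE; apply/orP; left; apply/nbhdP; exists x.
      rewrite inE; case: (boolP (y \in nbhd r B)) => //= yB.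
      by apply/nbhdP; exists x => //; rewrite /r' rxy.
    rewrite cardsU; lia.
  have f1B x : x \in B -> f1 x \in nbhd r B.
    by move=> xB; apply/nbhdP; exists x => //; apply: f1r.
  have f2B x : x \in A -> x \notin B -> f2 x \notin nbhd r B.
    by move=> xA xB; have := f2r x; rewrite inE xA xB => /(_ isT)/andP[].
  exists (fun x => if x \in B then f1 x else f2 x); split=> [x xA|x y xA yA].
    case: ifPn => xB; first exact: f1r.
    by have := f2r x; rewrite inE xA xB => /(_ isT)/andP[].
  case: ifPn => xB; case: ifPn => yB eqf.
  - exact: f1I.
  - by have := f2B y yA yB; rewrite -eqf f1B.
  - by have := f2B x xA xB; rewrite eqf f1B.
  - by apply: f2I => //; rewrite inE ?xA ?yA ?xB ?yB.
have [y ray] : exists y, r a y.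
  have := hallA [set a]; rewrite sub1set aA cards1 => /(_ isT)/card_gt0P[y].
  by case/nbhdP=> x /set1P-> ?; exists y.
pose r' x z := r x z && (z != y).
have [||f [fr fI]] := IHn r' (A :\ a); first by rewrite (cardsD1 a) aA in leAn.
  move=> C /subsetD1P[CA aC]; have [->|Cn0] := eqVneq C set0.
    by rewrite cards0.
  (* The spare neighbour makes up for the loss of [y]. *)
  have ltC : #|C| < #|nbhd r C|.
    move: noTight; rewrite negb_exists => /forallP/(_ C).
    rewrite Cn0 properE CA negb_and -ltnNge negbK => /orP[/subsetP/(_ a aA)|//].
    by rewrite (negPf aC).
  have /subset_leq_card : nbhd r C :\ y \subset nbhd r' C.
    apply/subsetP=> z /setD1P[zy /nbhdP[x xC rxz]].
    by apply/nbhdP; exists x => //; rewrite /r' rxz.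
  have := cardsD1 y (nbhd r C); lia.
have fA x : x \in A -> x != a -> r x (f x) && (f x != y).
  by move=> xA xa; apply: fr; rewrite !inE xa.
exists (fun x => if x == a then y else f x); split=> [x xA|x z xA zA].
  by case: eqVneq => [->//|xa]; have /andP[] := fA x xA xa.
case: eqVneq => [->|xa]; case: eqVneq => [->|za] //.
- by have /andP[_ /eqP] := fA z zA za => ? /esym.
- by have /andP[_ /eqP] := fA x xA xa.
- by apply: fI; rewrite !inE ?xa ?za.
Qed.

(** * Vertex covers and the two graph parameters *)

Section EternalCover.

Variables (T : finType) (e : rel T).
Hypothesis e_sym : symmetric e.
Implicit Types (S P : {set T}) (C : {set {set T}}).

Lemma induced_sym S : symmetric (induced e S).
Proof. by move=> x y; rewrite /induced /= e_sym (andbC (x \in S)). Qed.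

Lemma vertex_coverP S :
  reflect (forall x y, e x y -> (x \in S) || (y \in S)) (vertex_cover e S).
Proof.
apply: (iffP forallP) => [H x y exy|H x].
  by have /forallP/(_ y)/implyP := H x; apply.
by apply/forallP=> y; apply/implyP; apply: H.
Qed.

Lemma connect_induced_mem S x y :
  connect (induced e S) x y -> x \in S -> y \in S.
Proof.
case/connectP=> p; elim/last_ind: p => [_ -> //|p z _].
by rewrite rcons_path last_rcons => /andP[_ /andP[/andP[_ zS] _]] ->.
Qed.

Lemma mvc_le S : vertex_cover e S -> mvc e <= #|S|.
Proof.
by move=> vcS; rewrite /mvc; case: arg_minnP => [|M _]; [apply: vertex_coverT|apply].
Qed.

Lemma evc_attained : exists2 S, evc_configuration e S & #|S| = evc e.
Proof.
rewrite /evc; case: arg_minnP => [|S cS _]; first exact: evc_configurationT.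
by exists S.
Qed.

Lemma evc_le S : evc_configuration e S -> evc e <= #|S|.
Proof.
move=> cS; rewrite /evc.
by case: arg_minnP => [|M _]; [apply: evc_configurationT|apply].
Qed.

Lemma mvc_le_evc : mvc e <= evc e.
Proof.
have [S /existsP[C /andP[/and3P[/forall_inP vcC _ _] SC]] <-] := evc_attained.
exact/mvc_le/vcC.
Qed.

Lemma defendsC u v S S' : defends e u v S S' = defends e v u S S'.
Proof. by rewrite /defends; apply: eq_existsb => f; rewrite orbC. Qed.

(** * Cut vertices of a connected graph, and necessity *)

Section Connected.

Hypothesis e_conn : connected_on e [set: T].

Lemma connectT x y : connect e x y.
Proof.
have /forall_inP/(_ x (in_setT x))/forall_inP/(_ y (in_setT y)) := e_conn.
by rewrite (@eq_connect _ _ e) // => a b; rewrite /induced /= !inE.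
Qed.

Lemma crossing_edge P a b :
  a \in P -> b \notin P -> exists x y, [/\ e x y, x \in P & y \notin P].
Proof.
move=> aP bP; have [/existsP[x /existsP[y /and3P[]]]|noE] :=
  boolP [exists x, exists y, [&& e x y, x \in P & y \notin P]].
  by exists x, y.
have clP : closed e P.
  apply: intro_closed => [|x y exy xP]; first exact/sym_connect_sym.
  apply: contraR noE => yP.
  by apply/existsP; exists x; apply/existsP; exists y; rewrite exy xP.
by have := closed_connect clP (connectT a b); rewrite aP (negPf bP).
Qed.

(** Turns the component count into a separated pair: if [r] reached all of G - x, then G - x would
    have one component, just like G. *)
Lemma cut_vertex_separates x r : x \in cut_vertices e -> r != x ->
  exists2 w, w != x & ~~ connect (induced e (~: [set x])) r w.
Proof.
rewrite inE => cutx rx; apply/exists_inP; apply: contraLR cutx.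
rewrite negb_exists_in => /forall_inP conn; rewrite -leqNgt.
set e' := induced e _ in conn *.
have compT : n_comp e T = 1.
  rewrite -(n_comp_connect (sym_connect_sym e_sym) r).
  by apply: eq_n_comp_r => y; rewrite [RHS]connectT.
have sym' : connect_sym e' by apply/sym_connect_sym/induced_sym.
rewrite compT -(n_comp_connect sym' r) (@eq_n_comp_r _ _ _ (connect e' r)) // => y.
rewrite !inE; have [->|yx] := eqVneq y x; last first.
  by have := conn y yx; rewrite negbK => ->.
apply/esym/negbTE; apply/negP=> rcx.
by have := connect_induced_mem rcx; rewrite !inE eqxx => /(_ rx).
Qed.

Lemma exists_neq (v : T) : 1 < #|T| -> exists w, w != v.
Proof. by move=> T2; apply/card_gt0P; rewrite cardC1; lia. Qed.

Lemma neighbor_exists (v : T) : 1 < #|T| -> exists u, e v u.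
Proof.
move=> /(exists_neq v)[w wv].
have [|z [y [ezy /set1P eqz _]]] := @crossing_edge [set v] v w (set11 v).
  by rewrite inE.
by exists y; rewrite -eqz.
Qed.

(* A vertex v <> r maximising the component of r in G - v is not a cut vertex. *)
Lemma noncut_vertex_exists : 1 < #|T| -> exists v, v \notin cut_vertices e.
Proof.
move=> T2; have /card_gt0P[r _] : 0 < #|T| by lia.
have [u ur] := exists_neq r T2.
pose comp v := [set y | connect (induced e (~: [set v])) r y].
case: (@arg_maxnP _ u (fun v => v != r) (fun v => #|comp v|) ur) => v vr max_v.
exists v; apply/negP=> cutv.
have rv : r != v by rewrite eq_sym.
have [w wv sep] := cut_vertex_separates cutv rv.
have rw : r != w by apply: contraNneq sep => <-; apply: connect0.
have compN x z : r != x -> z \in comp x -> z != x.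
  rewrite inE => xr /connect_induced_mem.
  by rewrite !inE xr => /(_ isT).
have step x y z : r != x -> y \in comp x -> e y z -> z != x -> z \in comp x.
  move=> xr yC eyz zx; have yx := compN _ _ xr yC; rewrite !inE in yC *.
  by apply: connect_trans yC (connect1 _); rewrite /induced /= !inE yx zx.
(* A walk from [r] inside [comp v] never meets [w], so it survives in G - w. *)
have sub : comp v \subset comp w.
  apply/subsetP=> z; rewrite !inE => /connectP[p].
  elim/last_ind: p z => [|p y IHp] z; first by move=> _ ->; apply: connect0.
  rewrite last_rcons => pth ->.
  have yv : y \in comp v.
    by rewrite inE; apply/connectP; exists (rcons p y); rewrite ?last_rcons.
  move: pth; rewrite rcons_path => /andP[pth /andP[_ ey]].
  have := @step w (last r p) y rw; rewrite !inE => -> //.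
    exact: IHp.
  by apply: contraNneq sep => <-; rewrite inE in yv.
(* An edge leaving [comp v] can only end at [v]. It puts [v] into [comp w], which is therefore
   strictly larger than [comp v]. *)
have [||x [y [exy xC yC]]] := @crossing_edge (comp v) r w.
- by rewrite inE connect0.
- by rewrite inE.
have yv : y = v by apply/eqP; apply: contraR yC; apply: step rv xC exy.
have ltC : #|comp v| < #|comp w|.
  apply/proper_card/properP; split=> //; exists v; last by rewrite yv in yC.
  by apply: (step _ x) => //; rewrite ?(subsetP sub) ?[v == w]eq_sym // -yv.
have := max_v w; rewrite eq_sym rw => /(_ isT); lia.
Qed.

(* The guards cannot cross between A and the rest of G - x, and the guard that
   answers the attack leaves A. *)
Lemma attack_into_empty_vertex C S x u (A : {set T}) :
    evc_class e C -> S \in C -> x \notin S -> e x u -> u \in A -> x \notin A ->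
    (forall a b, e a b -> a != x -> b \in A -> a \in A) ->
  exists2 S', S' \in C & #|S' :&: A| < #|S :&: A|.
Proof.
case/and3P=> _ _ /forall_inP evC SC xS exu uA xA sepA.
have /forallP/(_ x)/forallP/(_ u)/implyP/(_ exu)/exists_inP[S' S'C] := evC S SC.
case/existsP=> f /and4P[/forall_inP fe _ /eqP fS].
rewrite (negPf xS) /= => /andP[uS /eqP fu]; exists S' => //.
have /subset_leq_card : S' :&: A \subset f @: ((S :&: A) :\ u).
  apply/subsetP=> z /setIP[]; rewrite -fS => /imsetP[y yS ->] fyA.
  apply: imset_f; rewrite !inE yS /=; apply/andP; split.
    by apply: contraNneq xA => yu; rewrite -fu -yu.
  have /orP[/eqP<-//|eyf] := fe y yS.
  by apply: sepA eyf _ fyA; apply: contraNneq xS => <-.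
have := leq_imset_card f ((S :&: A) :\ u).
have := cardsD1 u (S :&: A); rewrite inE uS uA; lia.
Qed.

Lemma cut_vertices_occupied C S : 1 < #|T| ->
    evc_class e C -> S \in C -> #|S| = mvc e -> cut_vertices e \subset S.
Proof.
move=> T2 eC SC cardS; apply/subsetP=> x cutx; apply/negPn/negP=> xS.
have [r rx] := exists_neq x T2.
have [w wx sep] := cut_vertex_separates cutx rx.
pose A := [set y | connect (induced e (~: [set x])) r y].
pose B := ~: (x |: A).
have xA : x \notin A.
  rewrite inE; apply/negP=> /connect_induced_mem.
  by rewrite !inE eqxx rx => /(_ isT).
have rA : r \in A by rewrite inE connect0.
have wA : w \notin A by rewrite inE.
have sepA a b : e a b -> a != x -> b \in A -> a \in A.
  move=> eab ax bA; have bx : b != x by apply: contraNneq xA => <-.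
  rewrite inE in bA; rewrite inE; apply: connect_trans bA (connect1 _).
  by rewrite /induced /= !inE bx ax e_sym.
have inB z : (z \in B) = (z != x) && (z \notin A) by rewrite !inE negb_or.
have sepB a b : e a b -> a != x -> b \in B -> a \in B.
  move=> eab ax; rewrite !inB ax => /andP[bx]; apply: contra => aA.
  by apply: sepA aA => //; rewrite e_sym.
have [u [z [euz uA zA]]] := crossing_edge rA wA.
have zx : z = x.
  by apply/eqP; apply: contraR zA => zx; apply: sepA uA; rewrite // e_sym.
have [||u' [z' [euz' uB zB]]] := @crossing_edge B w r.
- by rewrite inB wx.
- by rewrite inB rA andbF.
have zx' : z' = x.
  by apply/eqP; apply: contraR zB => zx'; apply: sepB uB; rewrite // e_sym.
subst z z'; rewrite e_sym in euz; rewrite e_sym in euz'.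
have xB : x \notin B by rewrite inB eqxx.
have [S1 S1C ltA] := attack_into_empty_vertex eC SC xS euz uA xA sepA.
have [S2 S2C ltB] := attack_into_empty_vertex eC SC xS euz' uB xB sepB.
have /and3P[/forall_inP vcC _ _] := eC.
have /vertex_coverP vc1 := vcC S1 S1C; have /vertex_coverP vc2 := vcC S2 S2C.
pose W := x |: (S1 :&: A :|: S2 :&: B).
have vcW : vertex_cover e W.
  apply/vertex_coverP=> a b eab.
  rewrite /W !(in_setU1, in_setU, in_setI) !inB.
  have [//|ax] := eqVneq a x; have [|bx] := eqVneq b x; first by rewrite orbT.
  (* Both ends of an edge avoiding [x] lie on the same side, where [W] agrees with one of the covers
     [S1], [S2]. *)
  have AE : (a \in A) = (b \in A).
    by apply/idP/idP; apply: sepA => //; rewrite e_sym.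
  rewrite AE; case: (b \in A); rewrite ?andbT ?andbF ?orbF /=.
    exact: vc1.
  exact: vc2.
(* Adding [x] costs one vertex, while each of the two sides saves at least one. *)
have := mvc_le vcW; rewrite -cardS /W.
have [+ _] := leq_card_setU [set x] (S1 :&: A :|: S2 :&: B).
have [+ _] := leq_card_setU (S1 :&: A) (S2 :&: B); rewrite cards1.
have : #|S :&: A| + #|S :&: B| <= #|S|.
  rewrite -(cardsID A S) leq_add2l; apply/subset_leq_card/subsetP=> y.
  by rewrite in_setI inB in_setD => /and3P[-> _ ->].
move: ltA ltB; clear; lia.
Qed.

Lemma evc_eq_mvc_cover v : 1 < #|T| -> evc e = mvc e ->
  exists2 S, min_vertex_cover e S & cut_vertices e :|: [set v] \subset S.
Proof.
move=> T2 eq_em; have [S cS cardS] := evc_attained.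
case/existsP: cS => C /andP[eC SC]; have /and3P[/forall_inP vcC cardC attC] := eC.
have cardCE S' : S' \in C -> #|S'| = mvc e.
  move=> S'C; have /forall_inP/(_ S SC)/forall_inP/(_ S' S'C)/eqP <- := cardC.
  by rewrite cardS.
suff [S' S'C vS'] : exists2 S', S' \in C & v \in S'.
  exists S'; first by rewrite /min_vertex_cover vcC ?cardCE /=.
  by rewrite subUset sub1set vS' (cut_vertices_occupied T2 eC) ?cardCE.
have [vS|vS] := boolP (v \in S); first by exists S.
have [u evu] := neighbor_exists v T2.
have /forall_inP/(_ S SC)/forallP/(_ v)/forallP/(_ u)/implyP/(_ evu) := attC.
case/exists_inP=> S' S'C /existsP[f /and4P[_ _ /eqP fS]].
rewrite (negPf vS) /= => /andP[uS /eqP fu]; exists S' => //.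
by rewrite -fS -fu imset_f.
Qed.

End Connected.

(** * Moves of the guards, and sufficiency *)

(* On the resulting cycle, [prev] moves every guard one step towards u, and sends
   u to the free position x. *)
Lemma path_to_set S S' u :
    connected_on e S -> u \in S -> ~~ (S \subset S') ->
  exists2 x, x \in S :\: S' & exists c, [/\ uniq c, u \in c,
    {in c, forall y, (y \in S) && ((y == x) || (y \in S'))},
    prev c u = x & {in c, forall y, y != u -> e (prev c y) y}].
Proof.
move=> connS uS /subsetPn[x0 x0S x0S'].
have /forall_inP/(_ u uS)/forall_inP/(_ x0 x0S)/connectP[p0] := connS.
move=> /shortenP[p pth Up _] lastp {p0}.
have hasN : has (fun z => z \notin S') (u :: p).
  by apply/hasP; exists x0 => //; rewrite lastp mem_last.
have allS : {in u :: p, forall y, y \in S}.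
  move=> y /(nthP u)[[|i] /= ltip <-//].
  by have /pathP/(_ i ltip) := pth => /(_ u)/andP[/andP[_ ->]].
have eP : sorted e (u :: p) by apply: sub_path pth => a b /andP[].
(* A variable in place of [u :: p] lets [split_find] cut the path at its first vertex [x] outside
   [S'], while [def_c] remembers that it starts at [u]. *)
have [c0 def_c] : exists c0, c0 = u :: p by eexists.
rewrite -def_c in hasN Up allS eP.
case/split_find: hasN def_c Up allS eP => x s1 s2 xN s1S'.
rewrite cat_uniq => def_c /and3P[Uc _ _] allS /cat_sorted2[eP _].
have xS : x \in S by apply: allS; rewrite mem_cat mem_rcons mem_head.
(* If [u] itself is outside [S'], then [x] is [u] and [c'] is empty. *)
have [c' def_c'] : exists c', rcons s1 x = u :: c'.
  by case: s1 def_c {s1S' Uc allS eP} => [|y s1] /= [-> _]; eexists.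
have lastc : last u c' = x by rewrite -(last_cons u u c') -def_c' last_rcons.
exists x; first by rewrite inE xN.
exists (u :: c'); rewrite mem_head -def_c'; split=> //.
- move=> y yc; rewrite allS ?mem_cat ?yc //=.
  move: yc; rewrite mem_rcons inE; case: eqVneq => //= _ ys1.
  by apply: contraR s1S' => yN; apply/hasP; exists y.
- rewrite def_c' in Uc *; have := cycle_prev Uc.
  by rewrite /= rcons_path lastc => /andP[_ /eqP <-].
(* The closing pair from [x] to [u] need not be an edge, so the relation is relaxed at [u] only. *)
move=> y yc yu; have : cycle (fun a b => e a b || (b == u)) (rcons s1 x).
  rewrite def_c' in eP *; rewrite /= rcons_path eqxx orbT andbT.
  by apply: sub_path eP => a b /= ->.
by move/prev_cycle/(_ yc); rewrite (negPf yu) orbF.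
Qed.

(** The guards on [u] and [v] swap places. *)
Lemma defends_both_in S u v : u \in S -> v \in S -> e u v -> defends e u v S S.
Proof.
move=> uS vS euv; apply/existsP; exists [ffun x => tperm u v x].
have tS x : x \in S -> tperm u v x \in S by case: tpermP => [->|->|].
apply/and4P; split.
- apply/forall_inP=> x _; rewrite ffunE; case: tpermP => [->|->|_ _].
  + by rewrite euv orbT.
  + by rewrite e_sym euv orbT.
  + by rewrite eqxx.
- by apply/dinjectiveP=> x y _ _; rewrite !ffunE; apply: perm_inj.
- apply/eqP/setP=> x; apply/imsetP/idP=> [[y yS ->]|xS].
    by rewrite ffunE tS.
  by exists (tperm u v x); [apply: tS|rewrite ffunE tpermK].
by rewrite uS ffunE tpermL eqxx.
Qed.

(* If B violates Hall's condition, trading B for v and the neighbours of B in S'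
   gives a minimum cover Y with S :\: Y contained in B, hence closer to S. *)
Lemma closest_cover_hall (X S S' : {set T}) v x :
    min_vertex_cover e S -> min_vertex_cover e S' ->
    X \subset S -> X \subset S' -> v \in S' -> v \notin S -> x \in S :\: S' ->
    (forall Y, min_vertex_cover e Y -> X \subset Y -> v \in Y ->
       #|S :\: S'| <= #|S :\: Y|) ->
  exists f : T -> T,
    [/\ {in S :\: S' :\ x, forall y, e y (f y)},
        {in S :\: S' :\ x, forall y, f y \in S' :\: S :\ v}
      & {in S :\: S' :\ x &, injective f}].
Proof.
case/andP=> vcS /eqP cardS /andP[vcS' _] XS XS' vS' vS xS closest.
pose r y z := e y z && (z \in S' :\: S :\ v).
have [B|f [fr fI]] := @hall _ r (S :\: S' :\ x); last first.
  by exists f; split=> // y /fr/andP[].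
case/subsetD1P=> BS xB; rewrite leqNgt; apply/negP=> ltB.
have {}BS y : y \in B -> (y \in S) && (y \notin S').
  by move/(subsetP BS); rewrite inE andbC.
pose Y := (S :\: B) :|: (v |: nbhd r B).
have vcY : vertex_cover e Y.
  apply/vertex_coverP.
  have half a b : e a b -> a \in B -> b \in Y.
    move=> eab aB; have /andP[aS aS'] := BS a aB.
    have bS' : b \in S'.
      by have /vertex_coverP/(_ a b eab) := vcS'; rewrite (negPf aS').
    have bB : b \notin B by apply: contraL bS' => /BS/andP[].
    rewrite !inE bB /=; case: (boolP (b \in S)) => //= bS.
    case: eqVneq => //= bv; apply/exists_inP; exists a => //.
    by rewrite /r eab !inE bv bS bS'.
  move=> a b eab; have [aB|aB] := boolP (a \in B).
    by rewrite (half a b) ?orbT.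
  have [bB|bB] := boolP (b \in B); first by rewrite (half b a) // e_sym.
  have /vertex_coverP/(_ a b eab) := vcS.
  by rewrite !inE aB bB /= => /orP[]->; rewrite ?orbT.
have subB : B \subset S by apply/subsetP=> y /BS/andP[].
have minY : min_vertex_cover e Y.
  rewrite /min_vertex_cover vcY eqn_leq mvc_le // andbT -cardS.
  (* Removing [B] frees more than [#|nbhd r B|] places, so there is room for [v] as well. *)
  have := cardsU (S :\: B) (v |: nbhd r B); have := cardsU1 v (nbhd r B).
  have := leq_b1 (v \notin nbhd r B).
  have := cardsID B S; rewrite (setIidPr subB) -/Y; lia.
have XY : X \subset Y.
  apply/subsetP=> y yX; rewrite !inE (subsetP XS) // andbT.
  by case: (boolP (y \in B)) => // /BS; rewrite (subsetP XS') ?andbF.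
have := closest Y minY XY; rewrite !inE eqxx orbT => /(_ isT).
(* [S :\: Y] lies in [B], which omits [x]. Setting [x] aside thus makes [Y] strictly closer to [S]
   than [S'] is. *)
rewrite leqNgt => /negP[]; apply/proper_card/properP; split.
  apply/subsetP=> y; rewrite !inE negb_or negb_and negbK.
  by case/andP=> /andP[/orP[/BS/andP[-> ->]|/negPf->]].
exists x; rewrite // !inE xB /=.
by move: xS; rewrite inE => /andP[_ ->].
Qed.

Lemma defends_one_in (X S S' : {set T}) u v :
    min_vertex_cover e S -> min_vertex_cover e S' -> connected_on e S ->
    X \subset S -> X \subset S' -> v \in S' -> v \notin S -> u \in S -> e u v ->
    (forall Y, min_vertex_cover e Y -> X \subset Y -> v \in Y ->
       #|S :\: S'| <= #|S :\: Y|) ->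
  defends e u v S S'.
Proof.
move=> minS minS' connS XS XS' vS' vS uS euv closest.
have eq_card : #|S| = #|S'|.
  by case/andP: minS => _ /eqP->; case/andP: minS' => _ /eqP->.
have SnS' : ~~ (S \subset S').
  apply: contra vS => sub; have /eqP-> // : S == S'.
  by rewrite eqEcard sub eq_card leqnn.
have [x xSS' [c [Uc uc cS prevu ec]]] := path_to_set connS uS SnS'.
have [g [ge gS gI]] :=
  closest_cover_hall minS minS' XS XS' vS' vS xSS' closest.
set D := S :\: S' :\ x in ge gS gI.
(* Off the cycle [prev c] is the identity, and on it only [u] has predecessor [x]; hence these
   guards end in [S :&: S']. *)
have prev_stay y : y \in S -> y \notin D -> y != u ->
    (prev c y \in S) && (prev c y \in S').
  move=> yS yD yu; have [yc|yc] := boolP (y \in c).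
    have pc : prev c y \in c by rewrite mem_prev.
    have /andP[-> /orP[/eqP eqx|-> //]] := cS _ pc.
    by case/eqP: yu; apply: (can_inj (next_prev Uc)); rewrite eqx prevu.
  have yx : y != x by apply: contraNneq yc => ->; rewrite -prevu mem_prev.
  rewrite prev_nth (negPf yc) yS /=.
  by move: yD; rewrite !inE yx yS andbT /= negbK.
pose f y := if y == u then v else if y \in D then g y else prev c y.
have gD y : y \in D -> [/\ g y != v, g y \notin S & g y \in S'].
  by move/gS; rewrite !inE => /and3P[].
have fS' y : y \in S -> f y \in S'.
  move=> yS; rewrite /f; case: eqVneq => // yu; case: ifPn => [/gD[]//|yD].
  by have /andP[] := prev_stay y yS yD yu.
(* The three rules have disjoint targets: [v], the vertices of [S'] outside [S] other than [v], and
   vertices of [S]. *)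
have fI : {in S &, injective f}.
  move=> y z yS zS; rewrite /f.
  case: (eqVneq y u) => [->|yu]; case: (eqVneq z u) => [->|zu] //.
  - case: ifPn => [/gD[/eqP ? _ _] /esym//|zD vE].
    by have /andP[] := prev_stay z zS zD zu; rewrite -vE (negPf vS).
  - case: ifPn => [/gD[/eqP ? _ _]//|yD vE].
    by have /andP[] := prev_stay y yS yD yu; rewrite vE (negPf vS).
  case: ifPn => yD; case: ifPn => zD eqf.
  - exact: gI.
  - have /andP[] := prev_stay z zS zD zu; rewrite -eqf.
    by have [_ /negPf->] := gD y yD.
  - have /andP[] := prev_stay y yS yD yu; rewrite eqf.
    by have [_ /negPf->] := gD z zD.
  - exact: (can_inj (next_prev Uc)).
apply/existsP; exists [ffun y => f y]; apply/and4P; split.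
- apply/forall_inP=> y yS; rewrite ffunE /f.
  have [->|yu] := eqVneq y u; first by rewrite euv orbT.
  have [yD|yD] := boolP (y \in D); first by rewrite ge ?orbT.
  have [yc|yc] := boolP (y \in c); first by rewrite e_sym ec ?orbT.
  by rewrite prev_nth (negPf yc) eqxx.
- by apply/dinjectiveP=> y z yS zS; rewrite !ffunE; apply: fI.
- rewrite (eq_imset _ (ffunE f)) eqEcard card_in_imset // eq_card leqnn andbT.
  by apply/subsetP=> _ /imsetP[y yS ->]; apply: fS'.
by rewrite uS ffunE /f eqxx eqxx.
Qed.

Lemma min_covers_evc_class (X : {set T}) :
    (forall S, min_vertex_cover e S -> X \subset S -> connected_on e S) ->
    (forall v, exists2 S, min_vertex_cover e S & X :|: [set v] \subset S) ->
  evc_class e [set S | min_vertex_cover e S && (X \subset S)].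
Proof.
move=> conn cover; apply/and3P; split.
- by apply/forall_inP=> S; rewrite inE => /andP[/andP[]].
- apply/forall_inP=> S; rewrite inE => /andP[/andP[_ /eqP->] _].
  by apply/forall_inP=> S'; rewrite inE => /andP[/andP[_ /eqP->] _].
apply/forall_inP=> S SC; have := SC; rewrite inE => /andP[minS XS].
have attack u v : e u v -> u \in S -> v \notin S ->
    [exists S' in [set S | min_vertex_cover e S && (X \subset S)],
       defends e u v S S'].
  move=> euv uS vS; have [S0 min0] := cover v.
  rewrite subUset sub1set => /andP[X0 v0].
  pose P Y := [&& min_vertex_cover e Y, X \subset Y & v \in Y].
  have P0 : P S0 by apply/and3P.
  case: (arg_minnP (fun Y => #|S :\: Y|) P0) => S' /and3P[min' X' v'] closest.
  apply/exists_inP; exists S'; first by rewrite inE min' X'.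
  apply: (@defends_one_in X) => //; first exact: conn.
  by move=> Y minY XY vY; apply: closest; apply/and3P.
apply/forallP=> u; apply/forallP=> v; apply/implyP=> euv.
have /andP[/vertex_coverP/(_ u v euv) uvS _] := minS.
have [uS|uS] := boolP (u \in S); have [vS|vS] := boolP (v \in S).
- by apply/exists_inP; exists S => //; apply: defends_both_in.
- exact: attack.
- rewrite e_sym in euv; have /exists_inP[S' S'C dS'] := attack v u euv vS uS.
  by apply/exists_inP; exists S'; rewrite 1?defendsC.
- by rewrite (negPf uS) (negPf vS) in uvS.
Qed.

End EternalCover.

Theorem theorem2 (T : finType) (e : rel T)
    (e_sym : symmetric e) (e_irr : irreflexive e)
    (card_T : 2 <= #|T|) (FG : class_F e) :
  evc e = mvc e <->
  (forall v : T, v \notin cut_vertices e ->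
     exists Sv : {set T},
       min_vertex_cover e Sv /\ cut_vertices e :|: [set v] \subset Sv).
Proof.
have /andP[e_conn /forallP connF] := FG; split=> [eq_em v _|cover].
  by have [S minS vS] := evc_eq_mvc_cover e_sym e_conn v card_T eq_em; exists S.
(* [cover] speaks of non-cut vertices only. One such vertex gives a cover [S0] containing all cut
   vertices, which serves for each of them and shows that the class is nonempty. *)
have [v0 v0N] := noncut_vertex_exists e_sym e_conn card_T.
have [S0 [min0]] := cover v0 v0N; rewrite subUset => /andP[X0 _].
pose C := [set S | min_vertex_cover e S && (cut_vertices e \subset S)].
have evcC : evc_class e C.
  apply: min_covers_evc_class => // [S minS XS|v].
    by have /implyP := connF S; apply; rewrite minS.
  have [vX|/cover[S [minS XvS]]] := boolP (v \in cut_vertices e); last by exists S.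
  by exists S0; rewrite // subUset X0 sub1set (subsetP X0).
apply/eqP; rewrite eqn_leq mvc_le_evc // andbT.
have /andP[_ /eqP <-] := min0; apply: evc_le => //.
by apply/existsP; exists C; rewrite evcC inE min0.
Qed.
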